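(* Let $\alpha>0$ and let $r\in C(0,+\infty)$ satisfy $r(x)>0$ for all $x>0$, $\int_0^1\frac{d\tau}{r(\tau)}<+\infty$ and $\int_1^\infty\frac{d\tau}{r(\tau)}=+\infty$. For $x>0$, $t\ge 0$ let $y(x,t)\ge x$ be defined by $\int_x^{y(x,t)}\frac{1}{r(\tau)}d\tau=t$. Then the family $(U_0(t))_{t\ge0}$ given by $$(U_0(t)f)(y)=\chi_{\{\int_0^y\frac{1}{r(\tau)}d\tau>t\}}\frac{r(X(y,t))f(X(y,t))}{r(y)}$$ is a $C_0$-semigroup on $X_{0,\alpha}$ if and only if $$\sup_{x>0}\frac{1+y(x,t)}{1+x}<+\infty\quad(t\ge0)$$ and the map $[0,+\infty)\ni t\mapsto\sup_{x>0}\frac{1+y(x,t)}{1+x}$ is locally bounded. In this case $$\|U_0(t)\|_{\mathcal{L}(X_{0,\alpha})}=\sup_{x>0}\frac{(1+y(x,t))^\alpha}{(1+x)^\alpha}.$$ This occurs if there exists $C>0$ such that $r(z)\le C(z+1)$ for all $z>0$; in this case $\|U_0(t)\|_{\mathcal{L}(X_{0,\alpha})}\le e^{\alpha Ct}$.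
   Context: $X_{0,\alpha}:=L^1(\mathbb{R}_+;(1+x)^\alpha dx)$ with $\mathbb{R}_+=(0,+\infty)$. For $t\ge0$ and $y>0$ with $\int_0^y\frac{d\tau}{r(\tau)}>t$, $X(y,t)\in(0,y]$ is defined by $\int_{X(y,t)}^y\frac{1}{r(\tau)}d\tau=t$; $(U_0(t)f)(y)$ is understood to be $0$ for the other $y$. *)

(* Defs.v *)
From HB Require Import structures.
From mathcomp Require Import all_boot all_order all_algebra.
From mathcomp Require Import all_classical all_reals all_analysis.
From mathcomp Require Import measurable_realfun.

Set Implicit Arguments.
Unset Strict Implicit.
Unset Printing Implicit Defensive.

Import Order.TTheory GRing.Theory Num.Theory.
Import numFieldNormedType.Exports.

Local Open Scope classical_set_scope.
Local Open Scope ring_scope.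

(* Elements of L^1(mu) are handled through representatives in [Lfun mu 1], and
   equality in L^1(mu) is equality mu-almost everywhere. *)
Section L1_operators.
Context d (T : measurableType d) (R : realType).
Variable mu : {measure set T -> \bar R}.

Record bounded_L1_operator (U : (T -> R) -> (T -> R)) : Prop := {
  L1op_stable : forall f, f \in Lfun mu 1 -> U f \in Lfun mu 1;
  L1op_ae : forall f g, f \in Lfun mu 1 -> g \in Lfun mu 1 ->
    f = g %[ae mu] -> U f = U g %[ae mu];
  L1op_linear : forall (a : R) f g, f \in Lfun mu 1 -> g \in Lfun mu 1 ->
    U (fun x => a * f x + g x) = (fun x => a * U f x + U g x) %[ae mu];
  L1op_bounded : exists M : R, forall f, f \in Lfun mu 1 ->
    ('N[mu]_1[EFin \o U f] <= M%:E * 'N[mu]_1[EFin \o f])%E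
}.

(* Only the operators [U t] with [0 <= t] are relevant. *)
Record C0_semigroup_L1 (U : R -> (T -> R) -> (T -> R)) : Prop := {
  C0_operator : forall t, 0 <= t -> bounded_L1_operator (U t);
  C0_id : forall f, f \in Lfun mu 1 -> U 0 f = f %[ae mu];
  C0_add : forall s t f, 0 <= s -> 0 <= t -> f \in Lfun mu 1 ->
    U (s + t) f = U s (U t f) %[ae mu];
  C0_cvg : forall f, f \in Lfun mu 1 ->
    ('N[mu]_1[EFin \o (fun x => (U t f x - f x)%R)] @[t --> 0^'+] --> 0)%E
}.

Definition L1_opnorm (U : (T -> R) -> (T -> R)) : \bar R :=
  ereal_sup [set 'N[mu]_1[EFin \o U f]%E | f in
    [set f : T -> R | f \in Lfun mu 1 /\ ('N[mu]_1[EFin \o f] <= 1)%E]].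

End L1_operators.

Section weighted_measure.
Context (R : realType).
Variable alpha : R.

(* (1 + x)^alpha dx on (0, +oo), as a measure on the real line that does not
   charge ]-oo, 0]; thus [Lfun (weight_measure alpha) 1] represents
   X_{0,alpha} = L^1((0, +oo); (1 + x)^alpha dx). *)
Definition weight_measure (A : set (measurableTypeR R)) : \bar R :=
  (\int[lebesgue_measure]_(x in A `&` `]0%R, +oo[) ((1 + x) `^ alpha)%:E)%E.


Let weight_measurable (D : set (measurableTypeR R)) :
  measurable_fun D (fun x : R => ((1 + x) `^ alpha)%:E).
Proof.
apply/measurable_EFinP; apply: measurable_funTS.
apply: (measurableT_comp (measurable_powR alpha)).
exact: measurable_funD.
Qed.

Let weight_measure0 : weight_measure set0 = 0%E.
Proof. by rewrite /weight_measure set0I integral_set0. Qed.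

Let weight_measure_ge0 A : (0 <= weight_measure A)%E.
Proof. by apply: integral_ge0 => x _; rewrite lee_fin powR_ge0. Qed.

Let weight_measure_sigma_additive : semi_sigma_additive weight_measure.
Proof.
move=> F mF tF mUF; rewrite /weight_measure setI_bigcupl ge0_integral_bigcup//=.
- apply: is_cvg_ereal_nneg_natsum_cond => n _ _.
  by apply: integral_ge0 => x _; rewrite lee_fin powR_ge0.
- by move=> n; exact: measurableI.
- by move=> x _; rewrite lee_fin powR_ge0.
- apply/trivIsetP => i j _ _ ij.
  move/trivIsetP : tF => /(_ i j Logic.I Logic.I ij) Fij.
  by rewrite setIACA Fij set0I.
Qed.

HB.instance Definition _ := isMeasure.Build _ _ _ weight_measure
  weight_measure0 weight_measure_ge0 weight_measure_sigma_additive.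

End weighted_measure.

Section transport.
Context (R : realType).
Variable r : R -> R.

Definition int_inv (a b : R) : \bar R :=
  (\int[lebesgue_measure]_(tau in `]a, b[) ((r tau)^-1)%:E)%E.

(* y(x, t) *)
Definition flow (x t : R) : R :=
  xget x [set z | x <= z /\ int_inv x z = t%:E].

(* X(y, t) *)
Definition backflow (y t : R) : R :=
  xget y [set z | 0 < z <= y /\ int_inv z y = t%:E].

(* For [y <= 0 <= t] the condition fails, since [int_inv 0 y] is then [0]. *)
Definition U0 (t : R) (f : R -> R) (y : R) : R :=
  if (t%:E < int_inv 0 y)%E then
    r (backflow y t) * f (backflow y t) / r y
  else 0.

Definition flow_ratio (t : R) : \bar R :=
  ereal_sup [set ((1 + flow x t) / (1 + x))%:E | x in `]0, +oo[].

End transport.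

Definition locally_bounded_ge0 (R : realType) (g : R -> R) : Prop :=
  forall t : R, 0 <= t -> bounded_near g (within `[0, +oo[ (nbhs t)).

(* Main.v *)
Require Import Defs.
From HB Require Import structures.
From mathcomp Require Import all_boot all_order all_algebra.
From mathcomp Require Import all_classical all_reals all_analysis.
From mathcomp Require Import measurable_realfun ring lra.

(** The idea is to measure positions by travel time. Let [G x] be the integral
    of [1 / r] over [(0, x)]. Integrability at [0] and divergence at infinity
    make [G] an increasing bijection of [(0, +oo)]; with [H] its inverse,
    [y(x, t) = H (G x + t)] and [X(y, t) = H (G y - t)]. To a function [f] is
    attached its flux profile [J f s = r (H s) * f (H s)]. The substitution
    [x = H s] sends [dx / r x] to [ds] ([ge0_integral_change_of_variables]), so
    the norm of [f] in [L^1((1 + x)^alpha dx)] is the norm of [J f] in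
    [L^1(V ds)], where [V s = (1 + H s)^alpha] ([Lnorm_flux_profile]), and [U0 t]
    becomes the right translation [J (U0 t f) s = J f (s - t)]
    ([flux_profile_U0]). The theorem is thus a statement on right translations in
    [L^1((0, +oo), V ds)], for a nondecreasing weight [V >= 1].

    - Translating the variable of integration, the norm of the translate is the
      integral of [|F s| * V (s + t)]. Hence the operator norm is at most
      the supremum of [V (s + t) / V s]; it is at least that supremum, as shown
      by indicators of shrinking intervals [(s, u]] ([L1_opnorm_U0E]). Since
      [V (s + t) / V s] is the power [alpha] of [(1 + y(x, t)) / (1 + x)] with
      [x = H s], this gives the norm formula and the necessity of the finiteness
      condition.
    - That ratio is nondecreasing in [t], so once it is finite for every [t] it is
      locally bounded ([flow_ratio_locally_bounded]).
    - Conversely, if the ratio is finite, translations by [t <= 1] are uniformly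
      bounded, and strong continuity at [0] has to be checked on a dense set only:
      cut-offs of continuous functions to bounded intervals, for which dominated
      convergence applies ([wnorm_translation_continuous]). The semigroup law
      is a pointwise identity between profiles.
    - If [r z <= C * (z + 1)], then [C * G z - ln (1 + z)] is nondecreasing, so
      [ln ((1 + y(x, t)) / (1 + x))] is at most [C * t]
      ([ln_travel_le]). *)

Set Implicit Arguments.
Unset Strict Implicit.
Unset Printing Implicit Defensive.

Import Order.TTheory GRing.Theory Num.Theory.
Import numFieldNormedType.Exports.

Local Open Scope classical_set_scope.
Local Open Scope ring_scope.

(** * Measures with a density and change of variables *)

Section density.
Context d (T : measurableType d) (R : realType).
Local Open Scope ereal_scope.

Import HBNNSimple.

(** By monotone convergence it suffices to treat simple functions, hence
    indicators, where the identity is the hypothesis on [nu]. *)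
Lemma ge0_integral_density (mu nu : {measure set T -> \bar R}) (h : T -> R) :
  measurable_fun [set: T] h -> (forall x, (0 <= h x)%R) ->
  (forall A, measurable A -> nu A = \int[mu]_(x in A) (h x)%:E) ->
  forall f, measurable_fun [set: T] f -> (forall x, 0 <= f x) ->
  \int[nu]_x f x = \int[mu]_x (f x * (h x)%:E).
Proof.
move=> mh h0 nuE f mf f0.
have mT : measurable [set: T] by [].
have mhE : measurable_fun [set: T] (EFin \o h) by exact/measurable_EFinP.
pose f_ := nnsfun_approx mT mf.
transitivity (limn (fun n => \int[nu]_x (f_ n x)%:E)).
  rewrite -monotone_convergence//.
  - by apply: eq_integral => y _; apply/esym/cvg_lim => //; exact: cvg_nnsfun_approx.
  - by move=> n; exact/measurable_EFinP/measurable_funP.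
  - by move=> n y _; rewrite lee_fin.
  - by move=> y _ m n mn; rewrite lee_fin; exact/lefP/nd_nnsfun_approx.
rewrite [X in limn X](_ : _ = (fun n => \int[mu]_x ((f_ n x)%:E * (h x)%:E))).
  rewrite -monotone_convergence//; last 3 first.
  - by move=> n; apply: emeasurable_funM => //; exact/measurable_EFinP.
  - by move=> n y _; rewrite mule_ge0// lee_fin.
  - move=> y _ m n mn; apply: lee_wpmul2r; first by rewrite lee_fin.
    by rewrite lee_fin; exact/lefP/nd_nnsfun_approx.
  apply: eq_integral => y _; apply/cvg_lim => //.
  by apply: cvgeZr => //; exact: cvg_nnsfun_approx.
apply/funext => n.
have mind (k : R) : measurable_fun [set: T]
  (fun x => (k * \1_(f_ n @^-1` [set k]) x)%:E : \bar R).
  exact/measurable_EFinP/measurable_funM.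
transitivity (\sum_(k \in range (f_ n)) k%:E * nu (f_ n @^-1` [set k])).
  under eq_integral do rewrite fimfunE -fsumEFin//.
  rewrite ge0_integral_fsum//; last first.
    by move=> y x _; rewrite nnfun_muleindic_ge0.
  apply: eq_fsbigr => k _.
  by rewrite integralZl_indic_nnsfun// integral_indic// setIT.
transitivity (\int[mu]_x \sum_(k \in range (f_ n))
    (k * \1_(f_ n @^-1` [set k]) x)%:E * (h x)%:E); last first.
  apply: eq_integral => x _.
  rewrite fimfunE -fsumEFin// [RHS]muleC ge0_mule_fsumr//; last first.
    by move=> k; rewrite nnfun_muleindic_ge0.
  by apply: eq_fsbigr => k _; rewrite muleC.
rewrite ge0_integral_fsum//; last 2 first.
- by move=> k; exact: emeasurable_funM.
- by move=> k x _; rewrite mule_ge0 ?lee_fin// -lee_fin nnfun_muleindic_ge0.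
apply: eq_fsbigr => k /[!inE] -[x _ fxk].
have k0 : (0 <= k)%R by rewrite -fxk.
rewrite nuE//.
under [RHS]eq_integral do rewrite EFinM -muleA.
rewrite ge0_integralZl_EFin//; last 2 first.
- by move=> y _; rewrite mule_ge0// lee_fin.
- apply: emeasurable_funM => //; exact/measurable_EFinP.
congr (_ * _); rewrite integral_mkcond; apply: eq_integral => y _.
rewrite patchE indicE; case: ifPn => _ /=; first by rewrite mul1e.
by rewrite mul0e.
Qed.

End density.

Section density_measure.
Context d (T : measurableType d) (R : realType).
Variables (mu : {measure set T -> \bar R}) (h : T -> R).
Hypotheses (mh : measurable_fun [set: T] h) (h_ge0 : forall x, 0 <= h x).
Local Open Scope ereal_scope.

(** The hypotheses on [h] are arguments so that the measure structure can be
    attached to the constant. *)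
Definition density_measure of measurable_fun [set: T] h & (forall x, 0 <= h x)%R :=
  fun A : set T => \int[mu]_(x in A) (h x)%:E.

Local Notation nu := (density_measure mh h_ge0).

Let nu0 : nu set0 = 0.
Proof. by rewrite /density_measure integral_set0. Qed.

Let nu_ge0 A : 0 <= nu A.
Proof. by apply: integral_ge0 => x _; rewrite lee_fin. Qed.

Let nu_sigma_additive : semi_sigma_additive nu.
Proof.
move=> F mF tF mUF; rewrite /density_measure ge0_integral_bigcup//=.
- by apply: is_cvg_ereal_nneg_natsum_cond => n _ _; exact: nu_ge0.
- by apply/measurable_EFinP; exact: measurable_funTS.
- by move=> x _; rewrite lee_fin.
Qed.

HB.instance Definition _ := isMeasure.Build _ _ _ nu nu0 nu_ge0 nu_sigma_additive.

End density_measure.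

Section change_of_variables.
Context (R : realType).
Local Notation lambda := (@lebesgue_measure R).
Local Open Scope ereal_scope.

(** The measure of density [k] is pushed forward by [G] to a measure giving each
    [`]a, b]] its length, and Lebesgue measure is the only such measure. *)
Lemma ge0_integral_change_of_variables (k G H : R -> R) :
  measurable_fun [set: R] k -> (forall x, 0 <= k x)%R ->
  {homo H : s t / (s < t)%R} -> cancel G H -> cancel H G ->
  (forall a b, (a <= b)%R ->
     \int[lambda]_(x in `]a, b]) (k x)%:E = (G b - G a)%:E) ->
  forall f : R -> R, measurable_fun [set: R] f -> (forall x, 0 <= f x)%R ->
  \int[lambda]_x (f x * k x)%:E = \int[lambda]_s (f (H s))%:E.
Proof.
move=> mk k0 H_mono GK HK kG f mf f0.
pose nu := density_measure lambda mk k0.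
have H_le : {mono H : s t / (s <= t)%R} by exact: le_mono.
have H_lt : {mono H : s t / (s < t)%R} by exact: leW_mono.
have mH : measurable_fun [set: R] H.
  by apply: nondecreasing_measurable => // s t st; rewrite H_le.
have mG : measurable_fun [set: R] G.
  by apply: nondecreasing_measurable => // x y xy; rewrite -H_le !GK.
pose G_mixin := isMeasurableFun.Build _ _ (measurableTypeR R) (measurableTypeR R) G mG.
pose G' : {mfun measurableTypeR R >-> measurableTypeR R} := HB.pack G G_mixin.
have push A : measurable A -> lambda A = pushforward nu G' A.
  move=> mA; apply: lebesgue_measure_unique => //= _ [[a b]] _ <-.
  rewrite /pushforward (_ : G @^-1` _ = `]H a, H b]%classic); last first.
    by apply/seteqP; split=> x /=; rewrite !in_itv/= -(H_lt a) -(H_le (G x)) !GK.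
  rewrite lebesgue_measure_itv/= lte_fin.
  have [ab|ba] := ltP a b.
    by rewrite /nu /density_measure kG ?H_le ?ltW// !HK.
  by rewrite set_itv_ge ?measure0// bnd_simp -leNgt H_le.
have mfH : measurable_fun [set: R] (fun s => (f (H s))%:E).
  by apply/measurable_EFinP; exact: measurableT_comp.
transitivity (\int[pushforward nu G']_s (f (H s))%:E); last first.
  by apply: eq_measure_integral => A mA _; exact/esym/push.
rewrite ge0_integral_pushforward//=; last by move=> x _; rewrite lee_fin.
rewrite (@ge0_integral_density _ _ _ lambda nu k)//=.
- by apply: eq_integral => x _; rewrite GK EFinM.
- by apply/measurable_EFinP; apply: measurableT_comp => //; exact: measurableT_comp.
- by move=> x; rewrite lee_fin.
Qed.

Lemma ge0_integral_translation (f : R -> R) (t : R) :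
  measurable_fun [set: R] f -> (forall x, 0 <= f x)%R ->
  \int[lambda]_s (f (s + t))%:E = \int[lambda]_s (f s)%:E.
Proof.
move=> mf f0.
rewrite -(@ge0_integral_change_of_variables (cst 1%R) (fun x => x - t)%R
  (fun x => x + t)%R)//=.
- by apply: eq_integral => s _; rewrite mulr1.
- by move=> a b ab; rewrite ltrD2r.
- by move=> x; rewrite subrK.
- by move=> x; rewrite addrK.
- move=> a b ab; rewrite integral_cst//= mul1e lebesgue_measure_itv/= lte_fin.
  rewrite opprB addrA subrK; move: ab; rewrite le_eqVlt => /predU1P[->|ab].
    by rewrite ltxx subrr.
  by rewrite ab EFinB.
Qed.

End change_of_variables.

(** * Translations in a weighted space of integrable functions *)

Section ereal_limits.
Context (R : realType).
Local Open Scope ereal_scope.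

Lemma ge0_cvge0P (T : Type) (F : set_system T) {FF : Filter F} (f : T -> \bar R) :
  (forall x, 0 <= f x) ->
  f @ F --> 0 <-> forall e : R, (0 < e)%R -> \forall x \near F, f x <= e%:E.
Proof.
move=> f0; split=> [f_cvg0 e e0|f_le].
  have : \forall x \near F, f x < e%:E.
    by apply: (f_cvg0 [set y | y < e%:E]); apply: open_ereal_lt'; rewrite lte_fin.
  by apply: filterS => x /ltW.
move=> A /= [e /= e0 eA].
have := f_le (e / 2)%R (divr_gt0 e0 (ltr0Sn _ _)).
apply: filterS => x; rewrite /preimage/=; move: (f0 x); case: (f x) => // y.
rewrite !lee_fin => y0 ye; apply: eA => /=.
by rewrite sub0r normrN ger0_norm// (le_lt_trans ye)// gtr_pMr// invf_lt1// ltr1n.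
Qed.

End ereal_limits.

Section weighted_translation.
Context (R : realType) (V : R -> R).
Hypotheses (V_nd : {homo V : s t / s <= t}) (V_ge0 : forall s, 0 <= V s).
Local Notation lambda := (@lebesgue_measure R).
Local Open Scope ereal_scope.

Definition wnorm (F : R -> R) : \bar R := \int[lambda]_s (`|F s| * V s)%:E.

Let mV : measurable_fun [set: R] V.
Proof. exact: nondecreasing_measurable. Qed.

Lemma measurable_wnorm_integrand (F : R -> R) : measurable_fun [set: R] F ->
  measurable_fun [set: R] (fun s => `|F s| * V s)%R.
Proof. by move=> mF; apply: measurable_funM => //; exact: measurableT_comp. Qed.

Lemma measurable_shift (F : R -> R) t : measurable_fun [set: R] F ->
  measurable_fun [set: R] (fun s => F (s - t)%R).
Proof. by move=> mF; apply: measurableT_comp => //; exact: measurable_funB. Qed.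

Lemma wnorm_ge0 (F : R -> R) : 0 <= wnorm F.
Proof. by apply: integral_ge0 => s _; rewrite lee_fin mulr_ge0. Qed.

Lemma le_wnormD (F G : R -> R) : measurable_fun [set: R] F ->
  measurable_fun [set: R] G ->
  wnorm (fun s => F s + G s)%R <= wnorm F + wnorm G.
Proof.
move=> mF mG; rewrite -ge0_integralD//; last 4 first.
- by move=> s _; rewrite lee_fin mulr_ge0.
- by apply/measurable_EFinP; exact: measurable_wnorm_integrand.
- by move=> s _; rewrite lee_fin mulr_ge0.
- by apply/measurable_EFinP; exact: measurable_wnorm_integrand.
apply: ge0_le_integral => //.
- by move=> s _; rewrite lee_fin mulr_ge0.
- apply/measurable_EFinP; apply: measurable_wnorm_integrand; exact: measurable_funD.
- by apply/measurable_EFinP; apply: measurable_funD; exact: measurable_wnorm_integrand.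
- by move=> s _; rewrite lee_fin -mulrDl ler_wpM2r// ler_normD.
Qed.

Lemma wnormB (F G : R -> R) :
  wnorm (fun s => F s - G s)%R = wnorm (fun s => G s - F s)%R.
Proof. by apply: eq_integral => s _; rewrite distrC. Qed.

Lemma wnorm_shift (F : R -> R) t : measurable_fun [set: R] F ->
  wnorm (fun s => F (s - t)%R) = \int[lambda]_s (`|F s| * V (s + t))%:E.
Proof.
move=> mF; rewrite /wnorm.
rewrite -(@ge0_integral_translation _ (fun s => `|F (s - t)| * V s)%R t).
- by apply: eq_integral => s _; rewrite addrK.
- by apply: measurable_wnorm_integrand; exact: measurable_shift.
- by move=> s; rewrite mulr_ge0.
Qed.

Lemma wnorm_shift_le (K t : R) (F : R -> R) : measurable_fun [set: R] F ->
  (forall s, s <= 0 -> F s = 0)%R ->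
  (forall s, 0 < s -> V (s + t) <= K * V s)%R -> (0 <= K)%R ->
  wnorm (fun s => F (s - t)%R) <= K%:E * wnorm F.
Proof.
move=> mF F0 VK K0; rewrite wnorm_shift// -ge0_integralZl_EFin//; last 2 first.
- by move=> s _; rewrite lee_fin mulr_ge0.
- by apply/measurable_EFinP; exact: measurable_wnorm_integrand.
apply: ge0_le_integral => //.
- by move=> s _; rewrite lee_fin mulr_ge0.
- apply/measurable_EFinP; apply: measurable_funM; first exact: measurableT_comp.
  by apply: measurableT_comp => //; exact: measurable_funD.
- by apply/measurable_EFinP; apply: measurable_funM => //; exact: measurable_wnorm_integrand.
- move=> s _; rewrite lee_fin mulrCA.
  have [s0|s0] := leP s 0%R; first by rewrite F0// normr0 !mul0r.
  by rewrite ler_wpM2l// VK.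
Qed.

Definition translation_continuous (F : R -> R) :=
  wnorm (fun s => F (s - t) - F s)%R @[t --> 0^'+] --> 0.

(** The translations have uniformly bounded norm for small times, so strong
    continuity passes to limits in the weighted norm. *)
Lemma translation_continuous_closed (K : R) (F : R -> R) : (0 <= K)%R ->
  (forall t s, 0 <= t <= 1 -> 0 < s -> V (s + t) <= K * V s)%R ->
  measurable_fun [set: R] F -> (forall s, s <= 0 -> F s = 0)%R ->
  (forall e : R, (0 < e)%R -> exists G : R -> R, [/\ measurable_fun [set: R] G,
     (forall s, s <= 0 -> G s = 0)%R, translation_continuous G &
     wnorm (fun s => F s - G s)%R <= e%:E]) ->
  translation_continuous F.
Proof.
move=> K0 VK mF F0 approx; apply/ge0_cvge0P => [t|e e0]; first exact: wnorm_ge0.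
(* The three errors add up to [K * d + d + d]. *)
pose d := (e / (K + 2))%R.
have d0 : (0 < d)%R by rewrite divr_gt0// ltr_wpDl.
have [G [mG G0 /ge0_cvge0P-/(_ (fun=> wnorm_ge0 _))/(_ d d0) cG FG]] := approx d d0.
near=> t.
have t01 : (0 <= t <= 1)%R.
  by apply/andP; split; [apply/ltW|]; near: t;
    [exact: nbhs_right_gt|exact: nbhs_right_le].
have mFG : measurable_fun [set: R] (fun s => F s - G s)%R by exact: measurable_funB.
rewrite [X in wnorm X](_ : _ = fun s => (F (s - t) - G (s - t)) +
    ((G (s - t) - G s) + (G s - F s)))%R; last by apply/funext => s; ring.
apply: (@le_trans _ _ (K%:E * d%:E + (d%:E + d%:E))); last first.
  rewrite -EFinM -!EFinD lee_fin -mulr2n -mulr_natl -mulrDl mulrC divfK//.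
  by rewrite gt_eqF// ltr_wpDl.
apply: le_trans (le_wnormD _ _) _.
- exact: (@measurable_shift (fun s => F s - G s)%R).
- apply: measurable_funD; last exact: measurable_funB.
  by apply: measurable_funB => //; exact: measurable_shift.
apply: leeD; last first.
  apply: le_trans (le_wnormD _ _) _.
  - by apply: measurable_funB => //; exact: measurable_shift.
  - exact: measurable_funB.
  apply: leeD; first by near: t.
  by rewrite wnormB.
apply: le_trans (lee_wpmul2l _ FG); last by rewrite lee_fin.
apply: (@wnorm_shift_le K t (fun s => F s - G s)%R) => //.
- by move=> s s0; rewrite F0// G0// subrr.
- by move=> s; exact: VK.
Unshelve. all: by end_near. Qed.

Lemma cutoff_eq0 (F : R -> R) (n s : R) : (s <= 0)%R -> (F \_ `]0%R, n]) s = 0%R.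
Proof. by move=> s0; rewrite patchE mem_setE/= in_itv/= ltNge s0. Qed.

Lemma measurable_cutoff (F : R -> R) (n : R) : measurable_fun [set: R] F ->
  measurable_fun [set: R] (F \_ `]0%R, n]).
Proof.
by move=> mF; apply/(measurable_restrictT _ _).1 => //; exact: measurable_funTS.
Qed.

(** Right translations only see the values to the left of a point, and the
    indicator of [`]0, n]] is continuous from the left; so the cut-off creates no
    exceptional points. *)
Lemma translation_continuous_cutoff (h : R -> R) (n : R) : (0 < n)%R ->
  continuous h -> translation_continuous (h \_ `]0%R, n]).
Proof.
move=> n0 h_cont; set g := _ \_ _.
have mh : measurable_fun [set: R] h by exact: continuous_measurable_fun.
have mg : measurable_fun [set: R] g by exact: measurable_cutoff.
have gE s : g s = if (0 < s <= n)%R then h s else 0%R.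
  by rewrite /g patchE mem_setE in_itv.
have [M M0 gM] : exists2 M, (0 <= M)%R & forall s, (`|g s| <= M)%R.
  have [||c _ hc] := @EVT_max R (fun s => `|h s|)%R 0 n; first exact: ltW.
    by apply: continuous_subspaceT => s; apply: cvg_norm; exact: h_cont.
  exists (`|h c|)%R => // s; rewrite gE; case: ifPn => [/andP[s0 sn]|_].
    by apply: hc; rewrite in_itv/= ltW.
  by rewrite normr0.
(* Dominated convergence needs a bound valid along the whole sequence, whence
   the truncation of times at [1]. *)
pose u1 (u : R) := Num.min u 1%R.
suff : wnorm (fun s => g (s - u1 t) - g s)%R @[t --> 0^'+] --> 0.
  apply: cvg_trans; apply: near_eq_cvg; near=> t.
  by rewrite /u1 min_l//; near: t; exact: nbhs_right_le.
apply/cvge_at_rightP => u [u0 u_cvg].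
pose c := ((M + M) * V (n + 1))%R.
have c0 : (0 <= c)%R by rewrite mulr_ge0// addr_ge0.
have u1_bnd k : (0 < u1 (u k) <= 1)%R.
  by rewrite /u1 lt_min u0 ltr01 ge_min lexx orbT.
have u1_cvg : u1 (u k) @[k --> \oo] --> (0 : R)%R.
  apply: (cvg_trans _ u_cvg); apply: near_eq_cvg; near=> k.
  by rewrite /u1 min_l//; near: k; exact: (cvgr_le _ u_cvg).
have g_left s : (g (s - u1 (u k)))%R @[k --> \oo] --> g s.
  have su : (s - u1 (u k))%R @[k --> \oo] --> s.
    by rewrite -[X in _ --> X]subr0; apply: cvgB => //; exact: cvg_cst.
  have [s0|s0] := leP s 0%R.
    apply: cvg_near_cst; near=> k; rewrite !gE.
    have := u1_bnd k; do 2?case: ifPn => //; lra.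
  have [sn|sn] := leP s n.
    have : (h (s - u1 (u k)))%R @[k --> \oo] --> h s.
      exact: (cvg_comp _ _ su (h_cont s)).
    rewrite gE s0 sn/=; apply: cvg_trans; apply: near_eq_cvg; near=> k.
    rewrite gE ifT//; apply/andP; split; last by have := u1_bnd k; lra.
    by near: k; exact: (cvgr_gt s su).
  apply: cvg_near_cst; near=> k; rewrite !gE [in RHS]ifF; last lra.
  rewrite ifF//; apply/negbTE; rewrite negb_and orbC -ltNge.
  by apply/orP; left; near: k; exact: (cvgr_gt s su).
rewrite [X in _ --> X](_ : _ = \int[lambda]_(s in [set: R]) cst 0 s); last first.
  by rewrite integral0.
apply: (@dominated_cvg _ _ _ lambda _ measurableT
   (fun k s => (`|g (s - u1 (u k)) - g s| * V s)%:E) (cst 0)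
   (fun s => c%:E * (\1_(`]0%R, (n + 1)%R]%classic) s)%:E)).
- move=> k; apply/measurable_EFinP; apply: measurable_wnorm_integrand.
  by apply: measurable_funB => //; exact: measurable_shift.
- move=> s _; apply: cvg_EFin; first exact: nearW.
  rewrite -[X in _ --> X](mul0r (V s)); apply: cvgM; last exact: cvg_cst.
  rewrite -(normr0 R) -(subrr (g s)); apply: cvg_norm; apply: cvgB => //.
  exact: cvg_cst.
- by move=> s _; rewrite fin_numM.
- by apply: integrableZl => //; exact: integrable_indic_itv.
- move=> k s _; rewrite -EFinM abse_EFin lee_fin ger0_norm; last first.
    by rewrite mulr_ge0.
  have := u1_bnd k; rewrite indicE mem_setE/= in_itv/=.
  have [/andP[s0 sn] _|sN u1k] := boolP (0 < s <= n + 1)%R.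
    rewrite mulr1 ler_pM//; last exact: V_nd.
    by rewrite (le_trans (ler_normB _ _))// lerD.
  by rewrite !gE; do 2?case: ifPn; rewrite ?subr0 ?normr0 ?mul0r ?mulr0//; lra.
Unshelve. all: by end_near. Qed.

Hypothesis V_ge1 : forall s, (0 < s)%R -> (1 <= V s)%R.

Lemma wnorm_cutoff_le (F : R -> R) (n : R) : (0 < n)%R ->
  measurable_fun [set: R] F ->
  wnorm (F \_ `]0%R, n]) <= (V n)%:E * \int[lambda]_(s in `]0%R, n]) `|(F s)%:E|.
Proof.
move=> n0 mF.
have mFE : measurable_fun `]0%R, n] (fun s => `|(F s)%:E|).
  by apply: measurableT_comp => //; apply/measurable_EFinP; exact: measurable_funTS.
rewrite -ge0_integralZl_EFin//.
rewrite /wnorm [leRHS]integral_mkcond/=.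
have mI : measurable (`]0%R, n]%classic : set R) by [].
apply: ge0_le_integral => //.
- by move=> s _; rewrite lee_fin mulr_ge0.
- by apply/measurable_EFinP; apply: measurable_wnorm_integrand; exact: measurable_cutoff.
- by apply/(measurable_restrictT _ _).1 => //; exact: emeasurable_funM.
- move=> s _; rewrite !patchE; case: ifPn => [|_]; last by rewrite normr0 mul0r.
  rewrite mem_setE/= in_itv/= => /andP[_ sn].
  by rewrite -EFinM lee_fin mulrC ler_wpM2r// V_nd.
Qed.

(** Two approximations: cutting [F] off at a large [n], and replacing it on
    [`]0, n]], where the weight is bounded, by a continuous function. *)
Lemma wnorm_translation_continuous (K : R) (F : R -> R) : (0 <= K)%R ->
  (forall t s, 0 <= t <= 1 -> 0 < s -> V (s + t) <= K * V s)%R ->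
  measurable_fun [set: R] F -> (forall s, s <= 0 -> F s = 0)%R ->
  wnorm F < +oo -> translation_continuous F.
Proof.
move=> K0 VK mF F0 Foo; apply: (translation_continuous_closed K0) => // e e0.
have cut : wnorm (fun s => F s - (F \_ `]0%R, k%:R]) s)%R @[k --> \oo] --> 0.
  rewrite [X in _ --> X](_ : _ = \int[lambda]_(s in [set: R]) cst 0 s); last first.
    by rewrite integral0.
  apply: (@dominated_cvg _ _ _ lambda _ measurableT
    (fun k s => (`|F s - (F \_ `]0%R, k%:R]) s| * V s)%:E) (cst 0)
    (fun s => (`|F s| * V s)%:E)).
  - move=> k; apply/measurable_EFinP; apply: measurable_wnorm_integrand.
    by apply: measurable_funB => //; exact: measurable_cutoff.
  - move=> s _; apply: cvg_near_cst; near=> k.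
    rewrite patchE mem_setE/= in_itv/=; case: ifPn; first by rewrite subrr normr0 mul0r.
    rewrite negb_and -leNgt => /orP[s0|]; first by rewrite F0// subr0 normr0 mul0r.
    by rewrite -ltNge ltNge => /negP[]; near: k; exact: nbhs_infty_ger.
  - by [].
  - apply/integrableP; split.
      by apply/measurable_EFinP; exact: measurable_wnorm_integrand.
    under eq_integral do rewrite abse_EFin ger0_norm ?mulr_ge0//.
    exact: Foo.
  - move=> k s _; rewrite abse_EFin lee_fin ger0_norm ?mulr_ge0// ler_wpM2r//.
    by rewrite patchE; case: ifPn; rewrite ?subrr ?normr0 ?subr0.
have /ge0_cvge0P-/(_ (fun=> wnorm_ge0 _))/(_ e e0)[N _ Ncut] := cut.
pose n := (N.+1%:R : R).
have n0 : (0 < n)%R by rewrite ltr0n.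
exists (F \_ `]0%R, n]); split.
- exact: measurable_cutoff.
- by move=> s; exact: cutoff_eq0.
- apply: (translation_continuous_closed K0) => //.
  + exact: measurable_cutoff.
  + by move=> s; exact: cutoff_eq0.
  move=> d d0.
  have intF : lambda.-integrable `]0%R, n] (EFin \o F).
    apply/integrableP; split; first by apply/measurable_EFinP; exact: measurable_funTS.
    apply: le_lt_trans Foo; rewrite /wnorm integral_mkcond.
    apply: ge0_le_integral => //.
    * by move=> s _; rewrite patchE; case: ifPn.
    * apply/(measurable_restrictT _ _).1 => //; apply: measurableT_comp => //.
      by apply/measurable_EFinP; exact: measurable_funTS.
    * by apply/measurable_EFinP; exact: measurable_wnorm_integrand.
    * move=> s _; rewrite patchE; case: ifPn => [|_]; last by rewrite lee_fin mulr_ge0.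
      rewrite mem_setE/= in_itv/= => /andP[s0 _].
      by rewrite lee_fin ler_peMr// V_ge1.
  have Ioo : lambda `]0%R, n]%classic < +oo.
    by rewrite lebesgue_measure_itv/=; case: ifP => _; rewrite ?ltry.
  have [|h [h_cont _ /ge0_cvge0P hF]] := @approximation_continuous_integrable _ _ F _ Ioo intF.
    exact: measurable_itv.
  have Vn0 : (0 < V n)%R by rewrite (lt_le_trans ltr01)// V_ge1.
  have [|m _ /(_ m (leqnn m)) /= hm] := hF _ (d / V n)%R (divr_gt0 d0 Vn0).
    by move=> k; exact: integral_ge0.
  have mh : measurable_fun [set: R] (h m) by exact: continuous_measurable_fun.
  exists (h m \_ `]0%R, n]); split.
  + exact: measurable_cutoff.
  + by move=> s; exact: cutoff_eq0.
  + exact: translation_continuous_cutoff.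
  rewrite [X in wnorm X](_ : _ = (fun s => F s - h m s)%R \_ `]0%R, n]); last first.
    by apply/funext => s; rewrite !patchE; case: ifPn; rewrite ?subrr.
  apply: (le_trans (wnorm_cutoff_le n0 _)); first exact: measurable_funB.
  have -> : d%:E = (V n)%:E * (d / V n)%:E.
    by rewrite -EFinM mulrC divfK// gt_eqF.
  by rewrite lee_wpmul2l// lee_fin V_ge0.
- exact: (Ncut N.+1 (leqnSn N)).
Unshelve. all: by end_near. Qed.

End weighted_translation.

(** * Travel time *)

Section travel_time.
Context (R : realType) (r : R -> R).
Local Notation lambda := (@lebesgue_measure R).

(** The value [1] on the nonpositive half-line makes [travel] below a bijection
    of the whole line with density [slowness]. *)
Definition slowness (x : R) : R := if 0 < x then (r x)^-1 else 1.

Definition speed (x : R) : R := if 0 < x then r x else 1.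

Definition travel (x : R) : R := if 0 < x then fine (int_inv r 0 x) else x.

Definition travel_inv (s : R) : R := xget 0 [set x | travel x = s].

Hypothesis r_cont : {within `]0, +oo[, continuous r}.
Hypothesis r_gt0 : forall x, 0 < x -> 0 < r x.
Hypothesis r_int0 :
  (\int[lambda]_(tau in `]0%R, 1%R[) ((r tau)^-1)%:E < +oo)%E.
Hypothesis r_inty :
  (\int[lambda]_(tau in `]1%R, +oo[) ((r tau)^-1)%:E = +oo)%E.

Lemma slowness_gt0 x : 0 < slowness x.
Proof. by rewrite /slowness; case: ifP => // x0; rewrite invr_gt0 r_gt0. Qed.

Lemma speed_gt0 x : 0 < speed x.
Proof. by rewrite /speed; case: ifP => // x0; rewrite r_gt0. Qed.

Lemma slownessE x : slowness x = (speed x)^-1.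
Proof. by rewrite /slowness /speed; case: ifP; rewrite ?invr1. Qed.

Let slowness_ge0 x : 0 <= slowness x.
Proof. exact/ltW/slowness_gt0. Qed.

Lemma r_continuous x : 0 < x -> {for x, continuous r}.
Proof.
have := r_cont; rewrite continuous_open_subspace; last exact: interval_open.
by move=> /(_ x) + x0; apply; rewrite inE/= in_itv/= x0.
Qed.

Let rV_continuous x : 0 < x -> {for x, continuous (fun y => (r y)^-1)}.
Proof.
move=> x0; have rx0 : r x != 0 by rewrite gt_eqF// r_gt0.
exact: (cvgV rx0 (r_continuous x0)).
Qed.

Lemma slowness_continuous x : 0 < x -> {for x, continuous slowness}.
Proof.
move=> x0; apply: (@cvg_trans _ ((r y)^-1 @[y --> x])).
  apply: near_eq_cvg; near=> y; rewrite /slowness ifT//.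
  by near: y; exact: lt_nbhsr.
rewrite /slowness x0; exact: rV_continuous.
Unshelve. all: by end_near. Qed.

Let measurable_extension (f : R -> R) :
  (forall x, 0 < x -> {for x, continuous f}) ->
  measurable_fun [set: R] (fun x => if 0 < x then f x else 1).
Proof.
move=> f_cont; apply: measurable_fun_if => //.
- exact: measurable_fun_ltr.
- rewrite setTI (_ : _ @^-1` _ = `]0, +oo[%classic); last first.
    by apply/seteqP; split => x /=; rewrite in_itv/= andbT.
  apply: open_continuous_measurable_fun; first exact: interval_open.
  by move=> x; rewrite inE/= in_itv/= andbT => /f_cont.
Qed.

Lemma measurable_speed : measurable_fun [set: R] speed.
Proof. by apply: measurable_extension; exact: r_continuous. Qed.

Lemma measurable_slowness : measurable_fun [set: R] slowness.
Proof.
by apply: (@measurable_extension (fun x => (r x)^-1)); exact: rV_continuous.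
Qed.

Let mslowE D : measurable_fun D (fun x => (slowness x)%:E).
Proof. by apply/measurable_EFinP; apply: measurable_funTS; exact: measurable_slowness. Qed.

Lemma int_invE a b : 0 <= a ->
  int_inv r a b = (\int[lambda]_(x in `]a, b]) (slowness x)%:E)%E.
Proof.
move=> a0; rewrite -integral_itv_bndo_bndc//.
apply: eq_integral => x; rewrite inE/= in_itv/= => /andP[ax _].
by rewrite /slowness (le_lt_trans a0 ax).
Qed.

Lemma slowness_integrable u : lambda.-integrable `]0, u] (EFin \o slowness).
Proof.
apply/integrableP; split; first exact: mslowE.
under eq_integral do rewrite gee0_abs ?lee_fin//.
apply: (@le_lt_trans _ _ (\int[lambda]_(x in
    (`]0%R, 1%R[%classic `|` `[1%R, Num.max 1%R u]%classic)) (slowness x)%:E)%E).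
  apply: ge0_subset_integral; [exact: measurable_itv|exact: measurableU|exact: mslowE| |].
  - by move=> ? _; rewrite lee_fin.
  - move=> x /=; rewrite !in_itv/= => /andP[x0 xu].
    by have [x1|x1] := ltP x 1; [left|right]; rewrite ?x0 ?x1 //= le_max xu orbT.
rewrite ge0_integral_setU//; last 3 first.
- exact: mslowE.
- by move=> x _; rewrite lee_fin.
- apply/disj_setPS => x /=; rewrite !in_itv/= => -[/andP[_ x1] /andP[+ _]].
  by rewrite leNgt x1.
rewrite lte_add_pinfty//.
  under eq_integral => x.
    rewrite inE/= in_itv/= => /andP[x0 _]; rewrite /slowness x0.
  over.
  exact: r_int0.
have : lambda.-integrable `[1, Num.max 1 u] (EFin \o slowness).
  apply: continuous_compact_integrable; first exact: segment_compact.
  apply: continuous_in_subspaceT => x; rewrite inE/= in_itv/= => /andP[x1 _].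
  by apply: slowness_continuous; exact: lt_le_trans x1.
move=> /integrableP[_]; apply: le_lt_trans.
apply: ge0_le_integral => //.
- by move=> x _; rewrite lee_fin.
- exact: mslowE.
- by apply: measurableT_comp => //; exact: mslowE.
- by move=> x _; rewrite lee_abs.
Qed.

Lemma travelE x : 0 <= x ->
  (travel x)%:E = (\int[lambda]_(y in `]0%R, x]) (slowness y)%:E)%E.
Proof.
rewrite le_eqVlt => /predU1P[<-|x0].
  by rewrite /travel ltxx set_itv_ge ?integral_set0// bnd_simp ltxx.
rewrite /travel x0 int_invE// fineK//.
by apply: integrable_fin_num => //; exact: slowness_integrable.
Qed.

Lemma integral_slownessD a b c : a <= b -> b <= c ->
  (\int[lambda]_(x in `]a, c]) (slowness x)%:E =
   \int[lambda]_(x in `]a, b]) (slowness x)%:E +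
   \int[lambda]_(x in `]b, c]) (slowness x)%:E)%E.
Proof.
move=> ab bc; rewrite -ge0_integral_setU//.
- by rewrite -itv_bndbnd_setU// bnd_simp.
- exact: mslowE.
- by move=> x _; rewrite lee_fin.
- apply/disj_setPS => x /=; rewrite !in_itv/= => -[/andP[_ xb] /andP[+ _]].
  by rewrite ltNge xb.
Qed.

Lemma integral_slowness a b : a <= b ->
  (\int[lambda]_(x in `]a, b]) (slowness x)%:E = (travel b - travel a)%:E)%E.
Proof.
have neg u v : u <= v -> v <= 0 ->
    (\int[lambda]_(x in `]u, v]) (slowness x)%:E = (v - u)%:E)%E.
  move=> uv v0; under eq_integral => x.
    rewrite inE/= in_itv/= => /andP[_ xv].
    rewrite /slowness ltNge (le_trans xv v0)/=.
  over.
  rewrite integral_cst//= mul1e lebesgue_measure_itv/= lte_fin EFinB.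
  by move: uv; rewrite le_eqVlt => /predU1P[->|->//]; rewrite ltxx subee.
move=> ab; have [b0|b0] := leP b 0.
  by rewrite neg// /travel !ltNge b0 (le_trans ab b0).
have [a0|a0] := leP 0 a; last first.
  rewrite (integral_slownessD (ltW a0) (ltW b0)) (neg a 0 (ltW a0) (lexx _)) -(travelE (ltW b0)).
  by rewrite -EFinD {3}/travel (lt_gtF a0) sub0r addrC.
have b_ge0 := le_trans a0 ab.
have : (travel b)%:E = ((travel a)%:E +
    \int[lambda]_(x in `]a, b]) (slowness x)%:E)%E.
  by rewrite !travelE// -integral_slownessD.
case: (\int[_]_(_ in _) _)%E => // s; rewrite -EFinD => -[->].
by rewrite addrAC subrr add0r.
Qed.

Lemma travel_le0 x : x <= 0 -> travel x = x.
Proof. by move=> x0; rewrite /travel ltNge x0. Qed.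

Lemma travel0 : travel 0 = 0.
Proof. by rewrite /travel ltxx. Qed.

Lemma travel_parameterized x : 0 <= x ->
  travel x = parameterized_integral lambda 0 x slowness.
Proof.
move=> x0; rewrite /parameterized_integral /Rintegral.
by rewrite -integral_itv_obnd_cbnd -?travelE.
Qed.

(** The fundamental theorem of calculus, [r] being continuous. *)
Lemma travel_is_derive (x : R) : 0 < x -> is_derive x 1 travel (slowness x).
Proof.
move=> x0; have x1 : x < x + 1 by rewrite ltrDl.
have ltx : (BRight 0 < BRight x)%O by rewrite bnd_simp.
have [] := continuous_FTC1 x1 (slowness_integrable _) ltx (slowness_continuous x0).
set F := fun _ => _ => dF F'x.
have near_travel : \forall y \near x, F y = travel y.
  near=> y; have y0 : 0 < y by near: y; exact: lt_nbhsr.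
  by rewrite /F /Rintegral -travelE// ltW.
split; first exact: near_eq_derivable dF.
by rewrite -(@near_eq_derive _ _ _ F)// -derive1E.
Unshelve. all: by end_near. Qed.

Lemma travel_continuous (x : R) : 0 < x -> {for x, continuous travel}.
Proof.
move=> x0; apply: differentiable_continuous; apply/derivable1_diffP.
by have [] := travel_is_derive x0.
Qed.

Lemma travel_ge0 x : 0 <= x -> 0 <= travel x.
Proof.
move=> x0; rewrite -lee_fin travelE//.
by apply: integral_ge0 => y _; rewrite lee_fin.
Qed.

Lemma travel_homo : {homo travel : x y / x < y}.
Proof.
have pos x y : 0 < x -> x < y -> travel x < travel y.
  move=> x0 xy; apply: (@gtr0_derive1_lt_oo _ travel 0 (y + 1)) => //.
  - by move=> z; rewrite in_itv/= => /andP[/travel_is_derive[]].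
  - move=> z; rewrite in_itv/= => /andP[/travel_is_derive z_derive _].
    by rewrite derive1E derive_val slowness_gt0.
  - by move=> z; rewrite inE/= in_itv/= => /andP[/travel_continuous].
  - by rewrite in_itv/= x0/=; lra.
  - by rewrite in_itv/=; lra.
move=> x y xy; have [y0|y0] := leP y 0.
  by rewrite !travel_le0// (le_trans (ltW xy)).
have [x0|x0] := ltP 0 x; first exact: pos.
rewrite (travel_le0 x0); apply: (le_lt_trans x0).
have y20 : 0 < y / 2 by rewrite divr_gt0.
by apply: (le_lt_trans (travel_ge0 (ltW y20))); apply: pos => //; lra.
Qed.

(** This is where the divergence of the integral of [1 / r] at infinity enters. *)
Lemma travel_unbounded s : exists2 b, 0 < b & s <= travel b.
Proof.
apply: contrapT => bounded.
have bnd b : 0 < b -> travel b < s.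
  by move=> b0; rewrite ltNge; apply/negP => sb; apply: bounded; exists b.
suff : (\int[lambda]_(tau in `]1%R, +oo[) (slowness tau)%:E <= s%:E)%E.
  under eq_integral => x.
    rewrite inE/= in_itv/= andbT => x1; rewrite /slowness (lt_trans ltr01 x1).
  over.
  by rewrite r_inty.
pose I (n : nat) : set (measurableTypeR R) := `]1%R, n%:R]%classic.
rewrite (_ : `]1%R, +oo[%classic = \bigcup_n I n); last first.
  apply/seteqP; split => x /=.
    rewrite in_itv/= andbT => x1; exists (Num.truncn x).+1 => //=.
    by rewrite /I/= in_itv/= x1 ltW// truncnS_gt.
  by move=> [n _ /=]; rewrite /I/= !in_itv/= => /andP[->].
have cvgI := @ge0_nondecreasing_set_cvg_integral _ _ _ I
  (fun x => (slowness x)%:E) lambda.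
apply: cvge_le (cvgI _ _ _ _).
- near=> n; have n1 : 1 <= n%:R :> R by near: n; exact: nbhs_infty_ger.
  rewrite integral_slowness// lee_fin.
  have := bnd n%:R (lt_le_trans ltr01 n1); have := travel_ge0 ler01; lra.
- move=> m n mn; rewrite subsetEset; apply: subset_itvl; rewrite bnd_simp.
  by rewrite ler_nat.
- by move=> n; exact: measurable_itv.
- by move=> n; exact: mslowE.
- by move=> n x _; rewrite lee_fin.
Unshelve. all: by end_near. Qed.

Lemma travel_surj s : exists x, travel x = s.
Proof.
have [s0|s0] := leP s 0; first by exists s; rewrite travel_le0.
have [b b0 sb] := travel_unbounded s.
have integrable0b : lambda.-integrable `[0, b] (EFin \o slowness).
  apply/integrableP; split; first exact: mslowE.
  rewrite -integral_itv_obnd_cbnd; last by apply: measurableT_comp => //; exact: mslowE.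
  by case/integrableP : (slowness_integrable b).
have cont0b : {within `[0, b], continuous travel}.
  have := parameterized_integral_continuous (ltW b0) integrable0b.
  apply: subspace_eq_continuous => x; rewrite mem_setE in_itv/= => /andP[x0 _].
  exact/esym/travel_parameterized.
have bnd : Num.min (travel 0) (travel b) <= s <= Num.max (travel 0) (travel b).
  by rewrite travel0 ge_min le_max (ltW s0) sb orbT.
by have [c _] := IVT (ltW b0) cont0b bnd; exists c.
Qed.

Lemma travel_mono : {mono travel : x y / x <= y}.
Proof. exact: le_mono travel_homo. Qed.

Lemma travel_lt : {mono travel : x y / x < y}.
Proof. exact: leW_mono travel_mono. Qed.

Lemma travel_invK : cancel travel_inv travel.
Proof. by move=> s; exact: (xgetPex 0 (travel_surj s)). Qed.

Lemma travelK : cancel travel travel_inv.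
Proof. by move=> x; apply: (mono_inj lexx le_anti travel_mono); rewrite travel_invK. Qed.

Lemma travel_inv_le : {mono travel_inv : s t / s <= t}.
Proof. by move=> s t; rewrite -travel_mono !travel_invK. Qed.

Lemma travel_inv_lt : {mono travel_inv : s t / s < t}.
Proof. exact: leW_mono travel_inv_le. Qed.

Lemma travel_gt0 x : (0 < travel x) = (0 < x).
Proof. by rewrite -[in LHS]travel0 travel_lt. Qed.

Lemma travel_inv_gt0 s : (0 < travel_inv s) = (0 < s).
Proof. by rewrite -travel_gt0 travel_invK. Qed.

Lemma int_inv_travel a b : 0 <= a -> a <= b ->
  int_inv r a b = (travel b - travel a)%:E.
Proof. by move=> a0 ab; rewrite int_invE// integral_slowness. Qed.

Lemma flowE x t : 0 < x -> 0 <= t -> flow r x t = travel_inv (travel x + t).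
Proof.
move=> x0 t0; apply: xget_unique.
- have xy : x <= travel_inv (travel x + t).
    by rewrite -travel_mono travel_invK lerDl.
  by split => //; rewrite (int_inv_travel (ltW x0) xy) travel_invK addrAC subrr add0r.
- move=> z [xz]; rewrite (int_inv_travel (ltW x0) xz) => -[<-].
  by rewrite addrC subrK travelK.
Qed.

Lemma backflowE y t : 0 <= t -> t < travel y ->
  backflow r y t = travel_inv (travel y - t).
Proof.
move=> t0 ty; apply: xget_unique.
- have zy : travel_inv (travel y - t) <= y.
    by rewrite -travel_mono travel_invK gerBl.
  have z0 : 0 < travel_inv (travel y - t) by rewrite travel_inv_gt0 subr_gt0.
  by split; [rewrite z0|rewrite (int_inv_travel (ltW z0) zy) travel_invK subKr].
- move=> z [/andP[z0 zy]]; rewrite (int_inv_travel (ltW z0) zy) => -[<-].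
  by rewrite subKr travelK.
Qed.

Lemma U0E t f y : 0 <= t -> U0 r t f y =
  if t < travel y then
    speed (travel_inv (travel y - t)) * f (travel_inv (travel y - t)) / speed y
  else 0.
Proof.
move=> t0; rewrite /U0.
have -> : (t%:E < int_inv r 0 y)%E = (t < travel y).
  have [y0|y0] := leP y 0.
    rewrite travel_le0// /int_inv set_itv_ge ?integral_set0 ?bnd_simp -?leNgt//.
    by rewrite lte_fin !ltNge t0 (le_trans y0).
  by rewrite (int_inv_travel (lexx 0) (ltW y0)) travel0 subr0 lte_fin.
case: ifPn => // ty; rewrite backflowE// /speed.
by rewrite travel_inv_gt0 subr_gt0 ty -travel_gt0 (le_lt_trans t0 ty).
Qed.

(** The function [C * travel z - ln (z + 1)] is nondecreasing: its derivative is
    [C / r z - 1 / (z + 1)]. *)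
Lemma ln_travel_le (C x y : R) : (forall z, 0 < z -> r z <= C * (z + 1)) ->
  0 < x -> x <= y -> ln (1 + y) - ln (1 + x) <= C * (travel y - travel x).
Proof.
move=> rC x0 xy.
pose g : R -> R := (C \*: travel) - (@ln R \o shift 1).
have g_derive (z : R) : 0 < z -> is_derive z 1 g (C * slowness z - (z + 1)^-1).
  move=> z0; have z1 : 0 < shift 1 z by rewrite /= addr_gt0.
  have dln := is_derive1_comp (is_derive1_ln z1) (is_derive_shift z 1 1).
  have := is_deriveB (is_deriveZ C (travel_is_derive z0)) dln.
  by rewrite mulr1.
suff : g x <= g y.
  rewrite /g -[leLHS]/(C * travel x - ln (x + 1)) -[leRHS]/(C * travel y - ln (y + 1)).
  by rewrite ![1 + _]addrC; lra.
apply: (@ger0_derive1_le_cc _ g x y) => //.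
- move=> z; rewrite in_itv/= => /andP[xz _].
  by have [] := g_derive z (lt_trans x0 xz).
- move=> z; rewrite in_itv/= => /andP[xz _].
  have z0 := lt_trans x0 xz; have dg := g_derive z z0.
  rewrite derive1E derive_val /slowness z0 subr_ge0.
  rewrite -[leLHS]mul1r ler_pdivrMr ?addr_gt0// mulrAC ler_pdivlMr ?r_gt0//.
  by rewrite mul1r rC.
- apply: derivable_within_continuous => z; rewrite in_itv/= => /andP[xz _].
  by have [] := g_derive z (lt_le_trans x0 xz).
- by rewrite in_itv/= lexx.
- by rewrite in_itv/= xy lexx.
Qed.

End travel_time.

(** * The semigroup in travel time coordinates *)

Section L1_seminorm.
Context d (T : measurableType d) (R : realType).
Variable mu : {measure set T -> \bar R}.
Local Open Scope ereal_scope.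

Lemma in_LfunP (f : T -> R) : f \in Lfun mu 1 <->
  measurable_fun [set: T] f /\ 'N[mu]_1[EFin \o f] < +oo.
Proof.
rewrite Lfun1_integrable Lnorm1; split=> [/integrableP[mf foo]|[mf foo]].
  by split => //; exact/measurable_EFinP.
by apply/integrableP; split => //; exact/measurable_EFinP.
Qed.

Lemma Lnorm1B_eq0 (f g : T -> R) : measurable_fun [set: T] f ->
  measurable_fun [set: T] g ->
  'N[mu]_1[EFin \o (fun x => f x - g x)%R] = 0 <-> f = g %[ae mu].
Proof.
move=> mf mg; have mfg : measurable_fun [set: T] (EFin \o (fun x => f x - g x)%R).
  by apply/measurable_EFinP; exact: measurable_funB.
split=> [/(Lnorm_eq0_eq0 mfg lte01)|fg].
  by apply: filterS => x /= + _ => /(_ I)[/eqP]; rewrite subr_eq0 => /eqP.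
rewrite Lnorm1; transitivity (\int[mu]_x (cst 0 x : \bar R)); last by rewrite integral0.
apply: ge0_ae_eq_integral => //; first exact: measurableT_comp.
by apply: filterS fg => x /= + _ => /(_ I) ->; rewrite subrr normr0.
Qed.

End L1_seminorm.

Section weighted_transport.
Context (R : realType) (alpha : R) (r : R -> R).
Local Notation lambda := (@lebesgue_measure R).
Local Notation mu := (@weight_measure R alpha).
Hypothesis alpha_gt0 : 0 < alpha.
Hypothesis r_cont : {within `]0, +oo[, continuous r}.
Hypothesis r_gt0 : forall x, 0 < x -> 0 < r x.
Hypothesis r_int0 :
  (\int[lambda]_(tau in `]0%R, 1%R[) ((r tau)^-1)%:E < +oo)%E.
Hypothesis r_inty :
  (\int[lambda]_(tau in `]1%R, +oo[) ((r tau)^-1)%:E = +oo)%E.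

Local Notation H := (travel_inv r).
Local Notation G := (travel r).

Implicit Types (f g : R -> R) (s t x y K : R).

Definition transported_weight (s : R) : R :=
  if 0 < s then (1 + travel_inv r s) `^ alpha else 0.
Local Notation V := transported_weight.

(** The flux [r f], read along the trajectory issued from [0] as a function of
    the travel time. *)
Definition flux_profile (f : R -> R) (s : R) : R :=
  if 0 < s then speed r (travel_inv r s) * f (travel_inv r s) else 0.
Local Notation J := flux_profile.

Let HK := travel_invK r_cont r_gt0 r_int0 r_inty.
Let GK := travelK r_cont r_gt0 r_int0 r_inty.
Let H_gt0 := travel_inv_gt0 r_cont r_gt0 r_int0 r_inty.
Let G_gt0 := travel_gt0 r_cont r_gt0 r_int0.
Let H_le := travel_inv_le r_cont r_gt0 r_int0 r_inty.
Let H_lt := travel_inv_lt r_cont r_gt0 r_int0 r_inty.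

Lemma weight_ge1 x : 0 < x -> 1 <= (1 + x) `^ alpha.
Proof.
move=> x0; rewrite -[leLHS](powRr0 (1 + x)) ler_powR ?lerDl ?ltW//.
Qed.

Lemma transported_weight_nd : {homo V : s t / s <= t}.
Proof.
move=> s t st; rewrite /V; case: ifPn => s0; last by case: ifPn => // _; exact: powR_ge0.
have t0 := lt_le_trans s0 st.
rewrite t0 ge0_ler_powR ?(ltW alpha_gt0)// ?nnegrE ?lerD2l ?H_le//.
- by rewrite addr_ge0// ltW// H_gt0.
- by rewrite addr_ge0// ltW// H_gt0.
Qed.

Lemma transported_weight_ge0 s : 0 <= V s.
Proof. by rewrite /V; case: ifP => // _; exact: powR_ge0. Qed.

Lemma transported_weight_ge1 s : 0 < s -> 1 <= V s.
Proof. by move=> s0; rewrite /V s0 weight_ge1// H_gt0. Qed.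

Lemma transported_weight_gt0 s : 0 < s -> 0 < V s.
Proof. by move=> s0; exact: lt_le_trans (transported_weight_ge1 s0). Qed.

Let mH : measurable_fun [set: R] H.
Proof. by apply: nondecreasing_measurable => // s t; rewrite H_le. Qed.

Let mG : measurable_fun [set: R] G.
Proof.
by apply: nondecreasing_measurable => // x y; rewrite (travel_mono r_cont r_gt0 r_int0).
Qed.

Lemma measurable_flux_profile f : measurable_fun [set: R] f ->
  measurable_fun [set: R] (J f).
Proof.
move=> mf; apply: measurable_fun_ifT => //; first exact: measurable_fun_ltr.
apply: measurable_funM; last exact: measurableT_comp.
by apply: measurableT_comp => //; exact: measurable_speed.
Qed.

Lemma flux_profile_le0 f s : s <= 0 -> J f s = 0.
Proof. by move=> s0; rewrite /J ltNge s0. Qed.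

Lemma flux_profileB f g s : J (fun x => f x - g x) s = J f s - J g s.
Proof. by rewrite /J; case: ifP; rewrite ?mulrBr ?subrr. Qed.

Lemma measurable_U0 t f : 0 <= t -> measurable_fun [set: R] f ->
  measurable_fun [set: R] (U0 r t f).
Proof.
move=> t0 mf; pose X y := H (G y - t).
have mX : measurable_fun [set: R] X.
  by apply: measurableT_comp => //; exact: measurable_funB.
have ms := measurable_speed r_cont.
rewrite (_ : U0 r t f = fun y => if t < G y then
    speed r (X y) * f (X y) * slowness r y else 0); last first.
  by apply/funext => y; rewrite U0E// slownessE.
apply: measurable_fun_ifT => //; first exact: measurable_fun_ltr.
apply: measurable_funM; last exact: measurable_slowness.
by apply: measurable_funM; exact: measurableT_comp.
Qed.

(** In the travel time coordinate the semigroup is right translation. *)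
Lemma flux_profile_U0 t f s : 0 <= t -> J (U0 r t f) s = J f (s - t).
Proof.
move=> t0; rewrite /J U0E// HK subr_gt0.
case: ifPn => [s0|]; last by rewrite -leNgt => s0; rewrite ltNge (le_trans s0).
case: ifPn => ts; last by rewrite mulr0.
by rewrite mulrC divfK// gt_eqF// speed_gt0.
Qed.

(** With [k = 1 / r] in the change of variables, the factor [r] of the flux
    compensates the density. *)
Lemma Lnorm_flux_profile f : measurable_fun [set: R] f ->
  ('N[mu]_1[EFin \o f])%E = wnorm V (J f).
Proof.
move=> mf; pose W (x : R) := if 0 < x then (1 + x) `^ alpha else 0.
have mW : measurable_fun [set: R] W.
  apply: measurable_fun_ifT => //; first exact: measurable_fun_ltr.
  by apply: (measurableT_comp (measurable_powR alpha)); exact: measurable_funD.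
have W0 x : 0 <= W x by rewrite /W; case: ifP => // _; exact: powR_ge0.
have muE A : measurable A -> mu A = (\int[lambda]_(x in A) (W x)%:E)%E.
  move=> mA; rewrite /mu integral_mkcondr; apply: eq_integral => x _.
  by rewrite patchE mem_setE/= in_itv/= andbT /W; case: ifP.
have ms := measurable_speed r_cont.
rewrite Lnorm1 (@ge0_integral_density _ (measurableTypeR R) R lambda mu W mW W0 muE)//; last first.
  by apply: measurableT_comp => //; exact/measurable_EFinP.
transitivity (\int[lambda]_x (`|f x| * W x * speed r x * slowness r x)%:E)%E.
  apply: eq_integral => x _ /=.
  by rewrite slownessE mulfK// gt_eqF// speed_gt0.
rewrite (ge0_integral_change_of_variables (measurable_slowness r_cont r_gt0)
  _ _ GK HK)//.
- apply: eq_integral => s _; congr EFin; rewrite /W /V /J H_gt0.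
  case: ifP => _; last by rewrite mulr0 mul0r mulr0.
  by rewrite normrM (gtr0_norm (speed_gt0 _ _))// mulrAC [speed _ _ * _]mulrC.
- by move=> x; exact/ltW/slowness_gt0.
- by move=> s t; rewrite H_lt.
- by move=> a b; exact: integral_slowness.
- apply: measurable_funM => //; apply: measurable_funM => //.
  exact: measurableT_comp.
- by move=> x; rewrite !mulr_ge0// ltW// speed_gt0.
Qed.

Lemma Lnorm_U0_sub t f g : 0 <= t -> measurable_fun [set: R] f ->
  measurable_fun [set: R] g ->
  ('N[mu]_1[EFin \o (fun x => (U0 r t f x - g x)%R)])%E =
  wnorm V (fun s => J f (s - t) - J g s).
Proof.
move=> t0 mf mg; rewrite Lnorm_flux_profile; last first.
  by apply: measurable_funB => //; exact: measurable_U0.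
congr wnorm; apply/funext => s.
by rewrite flux_profileB flux_profile_U0.
Qed.

Lemma Lnorm_U0 t f : 0 <= t -> measurable_fun [set: R] f ->
  ('N[mu]_1[EFin \o U0 r t f])%E = wnorm V (fun s => J f (s - t)).
Proof.
move=> t0 mf; rewrite Lnorm_flux_profile; last exact: measurable_U0.
by congr wnorm; apply/funext => s; rewrite flux_profile_U0.
Qed.

Lemma Lnorm_U0_le (K t : R) f : 0 <= t -> measurable_fun [set: R] f -> 0 <= K ->
  (forall s, 0 < s -> V (s + t) <= K * V s) ->
  ('N[mu]_1[EFin \o U0 r t f] <= K%:E * 'N[mu]_1[EFin \o f])%E.
Proof.
move=> t0 mf K0 VK; rewrite Lnorm_U0// Lnorm_flux_profile//.
apply: wnorm_shift_le => //.
- exact: transported_weight_nd.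
- exact: transported_weight_ge0.
- exact: measurable_flux_profile.
- by move=> s; exact: flux_profile_le0.
Qed.

(** Since the profile determines the norm, identities between elements of the
    weighted space can be checked on profiles. *)
Lemma ae_eq_flux_profile f g : measurable_fun [set: R] f ->
  measurable_fun [set: R] g -> (forall s, J f s = J g s) -> f = g %[ae mu].
Proof.
move=> mf mg fg; apply/Lnorm1B_eq0 => //.
rewrite Lnorm_flux_profile; last exact: measurable_funB.
rewrite /wnorm integral0_eq// => s _.
by rewrite flux_profileB fg subrr normr0 mul0r.
Qed.

Lemma U0_linear t a f g : 0 <= t ->
  U0 r t (fun x => a * f x + g x) = (fun x => a * U0 r t f x + U0 r t g x).
Proof.
move=> t0; apply/funext => y; rewrite !U0E//.
by case: ifP => _; [ring|rewrite mulr0 addr0].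
Qed.

Lemma U0_sub t f g : 0 <= t ->
  U0 r t (fun x => f x - g x) = (fun x => U0 r t f x - U0 r t g x).
Proof.
move=> t0; apply/funext => y; rewrite !U0E//.
by case: ifP => _; [ring|rewrite subrr].
Qed.

Definition weight_growth (t : R) :=
  ereal_sup [set (V (s + t) / V s)%:E | s in `]0, +oo[].

Lemma weight_growth_le (K t : R) : (weight_growth t <= K%:E)%E ->
  forall s, 0 < s -> V (s + t) <= K * V s.
Proof.
move=> tK s s0; rewrite -ler_pdivrMr ?transported_weight_gt0// -lee_fin.
apply: le_trans tK; apply: ereal_sup_ubound; exists s => //=.
by rewrite in_itv/= s0.
Qed.

Lemma weight_growth_ge0 t : (0 <= weight_growth t)%E.
Proof.
apply: le_ereal_sup_tmp; exists (V (1 + t) / V 1)%:E.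
  by exists 1 => //=; rewrite in_itv/= ltr01.
by rewrite lee_fin divr_ge0 ?transported_weight_ge0.
Qed.

Lemma weight_growthE t : 0 <= t -> weight_growth t =
  ereal_sup [set ((1 + flow r x t) `^ alpha / (1 + x) `^ alpha)%:E | x in `]0, +oo[].
Proof.
move=> t0; congr ereal_sup; apply/seteqP; split => z /= [x];
    rewrite in_itv/= andbT => x0 <-.
  exists (H x); first by rewrite in_itv/= andbT H_gt0.
  by rewrite flowE ?H_gt0// HK /V x0 (lt_le_trans x0)// lerDl.
exists (G x); first by rewrite in_itv/= andbT G_gt0.
have Gx0 : 0 < G x by rewrite G_gt0.
by rewrite flowE// /V GK Gx0 (lt_le_trans Gx0)// lerDl.
Qed.

Lemma le_powR (a b p : R) : 0 <= p -> 0 <= a -> a <= b -> a `^ p <= b `^ p.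
Proof. by move=> p0 a0 ab; rewrite ge0_ler_powR// nnegrE// (le_trans a0). Qed.

Lemma flow_gt0 t x : 0 <= t -> 0 < x -> 0 < flow r x t.
Proof.
by move=> t0 x0; rewrite flowE// H_gt0 (lt_le_trans (y := G x))// ?G_gt0// lerDl.
Qed.

Lemma ratio_ge0 t x : 0 <= t -> 0 < x -> 0 <= (1 + flow r x t) / (1 + x).
Proof. by move=> t0 x0; rewrite divr_ge0// addr_ge0// ltW// flow_gt0. Qed.

Lemma ratio_powR t x : 0 <= t -> 0 < x ->
  (1 + flow r x t) `^ alpha / (1 + x) `^ alpha = ((1 + flow r x t) / (1 + x)) `^ alpha.
Proof.
move=> t0 x0; have x1 : 0 < 1 + x by rewrite addr_gt0.
have y1 : 0 <= 1 + flow r x t by rewrite addr_ge0// ltW// flow_gt0.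
rewrite powRM ?invr_ge0 ?(ltW x1)// -[in RHS]powR_inv1 ?(ltW x1)//.
by rewrite powRAC powR_inv1// powR_ge0.
Qed.

Lemma flow_ratio_ge0 t : 0 <= t -> (0 <= flow_ratio r t)%E.
Proof.
move=> t0; apply: le_ereal_sup_tmp; exists ((1 + flow r 1 t) / (1 + 1))%:E.
  by exists 1 => //=; rewrite in_itv/= ltr01.
by rewrite lee_fin ratio_ge0.
Qed.

(** The second family is the first one raised to the power [alpha]. *)
Lemma flow_ratio_weight_growth t : 0 <= t ->
  (flow_ratio r t < +oo)%E <-> (weight_growth t < +oo)%E.
Proof.
move=> t0; rewrite weight_growthE//; split.
- move=> foo; apply: (@le_lt_trans _ _ ((fine (flow_ratio r t)) `^ alpha)%:E).
    apply: ge_ereal_sup => z [x /=]; rewrite in_itv/= andbT => x0 <-.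
    rewrite lee_fin ratio_powR//; apply: le_powR; [exact: ltW|exact: ratio_ge0|].
    rewrite -lee_fin fineK ?ge0_fin_numE ?flow_ratio_ge0//; apply: ereal_sup_ubound.
    by exists x => //=; rewrite in_itv/= x0.
  exact: ltry.
- have := weight_growth_ge0 t; rewrite weight_growthE//.
  set S := ereal_sup _ => S0 Soo.
  apply: (@le_lt_trans _ _ ((fine S) `^ (alpha^-1))%:E); last exact: ltry.
  apply: ge_ereal_sup => z [x /=]; rewrite in_itv/= andbT => x0 <-.
  rewrite lee_fin -[leLHS](powRr1 (ratio_ge0 t0 x0)) -[X in _ `^ X](divff (lt0r_neq0 alpha_gt0)).
  rewrite powRrM -ratio_powR//.
  apply: le_powR; [by rewrite invr_ge0 ltW|by rewrite divr_ge0 ?powR_ge0|].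
  rewrite -lee_fin fineK ?ge0_fin_numE//; apply: ereal_sup_ubound.
  by exists x => //=; rewrite in_itv/= x0.
Qed.

Lemma weight_growth_fine_le t : (weight_growth t < +oo)%E ->
  forall s, 0 < s -> V (s + t) <= fine (weight_growth t) * V s.
Proof.
move=> toy; apply: weight_growth_le.
by rewrite fineK// ge0_fin_numE// weight_growth_ge0.
Qed.

Lemma fine_weight_growth_ge0 t : 0 <= fine (weight_growth t).
Proof. exact/fine_ge0/weight_growth_ge0. Qed.

Lemma bounded_L1_operator_U0 t : 0 <= t -> (weight_growth t < +oo)%E ->
  bounded_L1_operator mu (U0 r t).
Proof.
move=> t0 toy; have K0 := fine_weight_growth_ge0 t.
have VK := weight_growth_fine_le toy.
split.
- move=> f /in_LfunP[mf foo]; apply/in_LfunP; split; first exact: measurable_U0.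
  apply: (le_lt_trans (Lnorm_U0_le t0 mf K0 VK)).
  by rewrite lte_mul_pinfty// lee_fin.
- move=> f g /in_LfunP[mf _] /in_LfunP[mg _] fg.
  apply/Lnorm1B_eq0; [exact: measurable_U0|exact: measurable_U0|].
  apply/eqP; rewrite eq_le Lnorm_ge0 andbT -U0_sub//.
  have mfg : measurable_fun [set: R] (fun x => f x - g x) by exact: measurable_funB.
  have fg0 : ('N[mu]_1[EFin \o (fun x => (f x - g x)%R)] = 0)%E by apply/Lnorm1B_eq0.
  by apply: (le_trans (Lnorm_U0_le t0 mfg K0 VK)); rewrite fg0 mule0.
- by move=> a f g _ _; rewrite U0_linear//; exact: aeW.
- exists (fine (weight_growth t)) => f /in_LfunP[mf _].
  exact: Lnorm_U0_le.
Qed.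

Lemma C0_semigroup_U0 : (forall t, 0 <= t -> (weight_growth t < +oo)%E) ->
  C0_semigroup_L1 mu (U0 r).
Proof.
move=> growth; split.
- by move=> t t0; apply: bounded_L1_operator_U0 => //; exact: growth.
- move=> f /in_LfunP[mf _].
  apply: ae_eq_flux_profile => //; first exact: measurable_U0.
  by move=> s; rewrite flux_profile_U0// subr0.
- move=> u t f u0 t0 /in_LfunP[mf _]; have ut0 := addr_ge0 u0 t0.
  have mUf := measurable_U0 t0 mf.
  apply: ae_eq_flux_profile => //; [exact: measurable_U0|exact: measurable_U0|].
  by move=> s; rewrite !flux_profile_U0// opprD addrA.
- move=> f /in_LfunP[mf foo].
  (* The weight being nondecreasing, its growth at time [1] bounds the earlier ones. *)
  have V1 t s : 0 <= t <= 1 -> 0 < s -> V (s + t) <= fine (weight_growth 1) * V s.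
    move=> /andP[t0 t1] s0.
    apply: le_trans (weight_growth_fine_le (growth 1 ler01) s0).
    by apply: transported_weight_nd; rewrite lerD2l.
  have Joo : (wnorm V (J f) < +oo)%E by rewrite -Lnorm_flux_profile.
  have := wnorm_translation_continuous transported_weight_nd transported_weight_ge0
    transported_weight_ge1 (fine_weight_growth_ge0 1) V1 (measurable_flux_profile mf)
    (@flux_profile_le0 f) Joo.
  apply: cvg_trans; apply: near_eq_cvg; near=> t.
  by rewrite Lnorm_U0_sub//; near: t; exact: nbhs_right_ge.
Unshelve. all: by end_near. Qed.

Lemma L1_opnorm_U0_le t : 0 <= t -> (L1_opnorm mu (U0 r t) <= weight_growth t)%E.
Proof.
move=> t0; have [->|toy] := eqVneq (weight_growth t) +oo%E; first exact: leey.
have {}toy : (weight_growth t < +oo)%E by rewrite ltey.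
apply: ge_ereal_sup => z [f /= [/in_LfunP[mf _] f1] <-].
have K0 := fine_weight_growth_ge0 t.
apply: (le_trans (Lnorm_U0_le t0 mf K0 (weight_growth_fine_le toy))).
rewrite -[leRHS]fineK ?ge0_fin_numE ?weight_growth_ge0// -[leRHS]mule1.
by rewrite lee_wpmul2l// lee_fin.
Qed.

Lemma integral_scaled_indic (k a b : R) : 0 <= k -> a <= b ->
  (\int[lambda]_s (k * \1_(`]a, b]%classic) s)%:E)%E = (k * (b - a))%:E.
Proof.
move=> k0 ab; under eq_integral do rewrite EFinM.
rewrite ge0_integralZl_EFin//; last exact/measurable_EFinP.
rewrite integral_indic//= setIT EFinM; congr (_ * _)%E.
rewrite lebesgue_measure_itv/= lte_fin.
by move: ab; rewrite le_eqVlt => /predU1P[->|->//]; rewrite ltxx subrr.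
Qed.

(** For a profile constant on [`]s, u]], the weight is at most [V u] before the
    translation and at least [V (s + t)] after it. The ratio tends to
    [V (s + t) / V s] as [u] decreases to [s]. *)
Lemma L1_opnorm_U0_ge_approx t s u : 0 <= t -> 0 < s -> s < u ->
  ((V (s + t) / V u)%:E <= L1_opnorm mu (U0 r t))%E.
Proof.
move=> t0 s0 su; have u0 := lt_trans s0 su.
have Vu0 := transported_weight_gt0 u0.
have us0 : 0 < u - s by rewrite subr_gt0.
(* The constant value of the profile; this choice makes the norm at most [1]. *)
pose c := ((u - s) * V u)^-1.
have c0 : 0 <= c by rewrite invr_ge0 mulr_ge0// ltW.
pose f y := c * \1_(`]s, u]%classic) (G y) * slowness r y.
have mf : measurable_fun [set: R] f.
  apply: measurable_funM; last exact: measurable_slowness.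
  by apply: measurable_funM => //; exact: measurableT_comp.
have Jf v : `|J f v| = c * \1_(`]s, u]%classic) v.
  have -> : J f v = c * \1_(`]s, u]%classic) v.
    rewrite /J /f HK; case: ifPn => [v0|].
      by rewrite slownessE mulrC divfK// gt_eqF// speed_gt0.
    rewrite -leNgt => v0; rewrite indicE mem_setE in_itv/=.
    by rewrite (le_gtF (le_trans v0 (ltW s0)))/= mulr0.
  by rewrite ger0_norm// mulr_ge0.
have mJf := measurable_flux_profile mf.
have mI : measurable_fun [set: R] (\1_(`]s, u]%classic) : R -> R) by [].
have mV : measurable_fun [set: R] V.
  by apply: nondecreasing_measurable => //; exact: transported_weight_nd.
have f1 : ('N[mu]_1[EFin \o f] <= 1)%E.
  rewrite Lnorm_flux_profile//.
  apply: (@le_trans _ _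
    (\int[lambda]_v ((u - s)^-1 * \1_(`]s, u]%classic) v)%:E)%E); last first.
    by rewrite integral_scaled_indic ?invr_ge0 ?(ltW us0) ?(ltW su)// mulVf// gt_eqF.
  apply: ge0_le_integral => //.
  - by move=> v _; rewrite lee_fin mulr_ge0// transported_weight_ge0.
  - by apply/measurable_EFinP; apply: measurable_wnorm_integrand => //; exact: transported_weight_nd.
  - by apply/measurable_EFinP; exact: measurable_funM.
  move=> v _; rewrite lee_fin Jf indicE mem_setE in_itv/=.
  case: (boolP (s < v <= u)) => [/andP[_ vu]|_]; last by rewrite !mulr0 mul0r.
  rewrite !mulr1 /c invfM -mulrA ler_piMr ?invr_ge0 ?(ltW us0)//.
  by rewrite mulrC ler_pdivrMr// mul1r transported_weight_nd.
apply: le_trans (ereal_sup_ubound _); last first.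
  exists f => //=; split => //; apply/in_LfunP; split => //.
  by rewrite (le_lt_trans f1)// ltry.
rewrite Lnorm_U0// wnorm_shift//; last first.
- exact: transported_weight_ge0.
- exact: transported_weight_nd.
have cV0 : 0 <= c * V (s + t) by rewrite mulr_ge0// transported_weight_ge0.
apply: (@le_trans _ _
  (\int[lambda]_v (c * V (s + t) * \1_(`]s, u]%classic) v)%:E)%E).
  rewrite integral_scaled_indic ?(ltW su)// lee_fin /c.
  rewrite [leRHS](_ : _ = V (s + t) / V u)//.
  by field; rewrite (gt_eqF us0) (gt_eqF Vu0).
apply: ge0_le_integral => //.
- by move=> v _; rewrite lee_fin mulr_ge0.
- by apply/measurable_EFinP; exact: measurable_funM.
- apply/measurable_EFinP; apply: measurable_funM.
    by apply: measurableT_comp => //; exact: mJf.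
  by apply: measurableT_comp => //; exact: measurable_funD.
move=> v _; rewrite lee_fin Jf mulrAC indicE mem_setE in_itv/=.
case: (boolP (s < v <= u)) => [/andP[sv _]|_]; last by rewrite !mulr0 !mul0r.
by rewrite !mulr1 ler_wpM2l// transported_weight_nd// lerD2r ltW.
Qed.

Lemma L1_opnorm_ge0 t : (0 <= L1_opnorm mu (U0 r t))%E.
Proof.
apply: le_ereal_sup_tmp; exists ('N[mu]_1[EFin \o U0 r t (cst 0%R)])%E.
  exists (cst 0) => //=; have norm0 : ('N[mu]_1[EFin \o (cst 0%R : R -> R)] = 0)%E.
    by rewrite Lnorm1 integral0_eq// => x _ /=; rewrite normr0.
  by split; [apply/in_LfunP; split => //|]; rewrite norm0.
exact: Lnorm_ge0.
Qed.

Lemma L1_opnorm_U0E t : 0 <= t -> L1_opnorm mu (U0 r t) = weight_growth t.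
Proof.
move=> t0; apply/eqP; rewrite eq_le L1_opnorm_U0_le//=.
have [->|Ny] := eqVneq (L1_opnorm mu (U0 r t)) +oo%E; first exact: leey.
have [K KE] : exists K, L1_opnorm mu (U0 r t) = K%:E.
  exists (fine (L1_opnorm mu (U0 r t))); rewrite fineK//.
  by rewrite ge0_fin_numE ?L1_opnorm_ge0// ltey.
apply: ge_ereal_sup => z [s /=]; rewrite in_itv/= andbT => s0 <-.
rewrite KE lee_fin ler_pdivrMr ?transported_weight_gt0//.
have x0 : 0 < H s by rewrite H_gt0.
(* The times [G x] decrease to [s] as the position [x] decreases to [H s]; in
   terms of [x] the weight is a continuous power function. *)
have approx : \forall x \near (H s)^'+, V (s + t) <= K * (1 + x) `^ alpha.
  near=> x; have sx : s < G x.
    by rewrite -H_lt GK; near: x; exact: nbhs_right_gt.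
  have := L1_opnorm_U0_ge_approx t0 s0 sx; rewrite KE lee_fin.
  rewrite ler_pdivrMr ?transported_weight_gt0 ?(lt_trans s0)//.
  by rewrite {2}/V (lt_trans s0 sx) GK.
have lim : K * (1 + x) `^ alpha @[x --> (H s)^'+] --> K * V s.
  rewrite /V s0; apply: cvg_at_right_filter; apply: cvgM; first exact: cvg_cst.
  have : {for 1 + H s, continuous (@powR R ^~ alpha)}.
    apply: differentiable_continuous; apply/derivable1_diffP.
    by apply: derivable_powR; rewrite in_itv/= andbT addr_gt0.
  apply: (@cvg_comp _ _ _ (fun x => 1 + x)).
  by apply: cvgD; [exact: cvg_cst|exact: cvg_id].
rewrite -(cvg_lim _ lim)//; apply: limr_ge => //.
by apply/cvg_ex; exists (K * V s).
Unshelve. all: by end_near. Qed.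

Lemma weight_growth_lty t : 0 <= t -> C0_semigroup_L1 mu (U0 r) ->
  (weight_growth t < +oo)%E.
Proof.
move=> t0 semi; rewrite -L1_opnorm_U0E//.
have [M UM] := L1op_bounded (C0_operator semi t0).
apply: (@le_lt_trans _ _ (Num.max M 0)%:E); last exact: ltry.
apply: ge_ereal_sup => z [f /= [fL f1] <-].
apply: (le_trans (UM f fL)); apply: (@le_trans _ _ ((Num.max M 0)%:E * 1)%E).
  apply: (@le_trans _ _ ((Num.max M 0)%:E * 'N[mu]_1[EFin \o f])%E).
    by apply: lee_wpmul2r; rewrite ?Lnorm_ge0// lee_fin le_max lexx.
  by apply: lee_wpmul2l => //; rewrite lee_fin le_max lexx orbT.
by rewrite mule1.
Qed.

Lemma flow_nd x u t : 0 < x -> 0 <= u -> u <= t -> flow r x u <= flow r x t.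
Proof.
by move=> x0 u0 ut; rewrite !flowE ?(le_trans u0)// H_le lerD2l.
Qed.

(** Local boundedness is automatic: the flow moves to the right as time
    increases, so the ratio is nondecreasing in time. *)
Lemma flow_ratio_locally_bounded :
  (forall t, 0 <= t -> (flow_ratio r t < +oo)%E) ->
  locally_bounded_ge0 (fun t => fine (flow_ratio r t)).
Proof.
move=> finite t t0; have t10 : 0 <= t + 1 by rewrite addr_ge0.
have ratio_fin u : 0 <= u -> flow_ratio r u \is a fin_num.
  by move=> u0; rewrite ge0_fin_numE ?flow_ratio_ge0// finite.
exists (fine (flow_ratio r (t + 1))); split; first exact: num_real.
move=> M /ltW tM; rewrite /within/=; near=> u => /=; rewrite in_itv/= andbT => u0.
rewrite ger0_norm; last by rewrite fine_ge0// flow_ratio_ge0.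
apply: le_trans tM; apply: fine_le; rewrite ?ratio_fin//.
apply: ge_ereal_sup => z [x /=]; rewrite in_itv/= andbT => x0 <-.
apply: le_ereal_sup_tmp; exists ((1 + flow r x (t + 1)) / (1 + x))%:E.
  by exists x => //=; rewrite in_itv/= x0.
rewrite lee_fin ler_wpM2r ?invr_ge0 ?addr_ge0 ?(ltW x0)// lerD2l.
have ut : u < t + 1 by near: u; apply: lt_nbhsl; rewrite ltrDl.
by apply: flow_nd => //; exact: ltW.
Unshelve. all: by end_near. Qed.

Lemma weight_growth_linear_speed (C t : R) :
  (forall z, 0 < z -> r z <= C * (z + 1)) -> 0 <= t ->
  (weight_growth t <= (expR (alpha * C * t))%:E)%E.
Proof.
move=> rC t0; rewrite weight_growthE//.
apply: ge_ereal_sup => z [x /=]; rewrite in_itv/= andbT => x0 <-.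
rewrite ratio_powR// lee_fin.
have -> : alpha * C * t = (C * t) * alpha by ring.
rewrite expRM; apply: le_powR; [exact: ltW|exact: ratio_ge0|].
have xy : x <= flow r x t by rewrite flowE// -[leLHS]GK H_le lerDl.
have x1 : 0 < 1 + x by rewrite addr_gt0.
have y1 : 0 < 1 + flow r x t by rewrite (lt_le_trans x1)// lerD2l.
rewrite ler_pdivrMr// -[leLHS]lnK ?posrE// -[X in _ <= _ * X]lnK ?posrE//.
rewrite -expRD ler_expR -lerBlDr.
have := ln_travel_le r_cont r_gt0 r_int0 rC x0 xy.
by rewrite [in X in _ <= _ * X]flowE// HK addrAC subrr add0r.
Qed.

End weighted_transport.

Theorem theorem3p1 (R : realType) (alpha : R) (r : R -> R)
  (alpha_gt0 : 0 < alpha)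
  (r_cont : {within `]0, +oo[, continuous r})
  (r_gt0 : forall x, 0 < x -> 0 < r x)
  (r_int0 : (\int[lebesgue_measure]_(tau in `]0%R, 1%R[) ((r tau)^-1)%:E < +oo)%E)
  (r_inty : (\int[lebesgue_measure]_(tau in `]1%R, +oo[) ((r tau)^-1)%:E = +oo)%E) :
  [/\ C0_semigroup_L1 (weight_measure alpha) (U0 r) <->
        (forall t, 0 <= t -> (flow_ratio r t < +oo)%E) /\
        locally_bounded_ge0 (fun t => fine (flow_ratio r t)),
      C0_semigroup_L1 (weight_measure alpha) (U0 r) ->
        forall t, 0 <= t ->
        L1_opnorm (weight_measure alpha) (U0 r t) =
        ereal_sup [set ((1 + flow r x t) `^ alpha / (1 + x) `^ alpha)%:E
                  | x in `]0, +oo[]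
    & forall C, 0 < C -> (forall z, 0 < z -> r z <= C * (z + 1)) ->
        C0_semigroup_L1 (weight_measure alpha) (U0 r) /\
        forall t, 0 <= t ->
        (L1_opnorm (weight_measure alpha) (U0 r t) <=
          (expR (alpha * C * t))%:E)%E].
Proof.
have growthP t : 0 <= t -> (flow_ratio r t < +oo)%E <-> (weight_growth alpha r t < +oo)%E.
  by move=> t0; exact: flow_ratio_weight_growth.
split.
- split=> [semi|[finite _]].
    have finite t : 0 <= t -> (flow_ratio r t < +oo)%E.
      by move=> t0; apply/growthP => //; exact: weight_growth_lty.
    by split => //; exact: flow_ratio_locally_bounded.
  by apply: C0_semigroup_U0 => // t t0; apply/growthP => //; exact: finite.
- by move=> _ t t0; rewrite L1_opnorm_U0E// weight_growthE.
- move=> C _ rC; split=> [|t t0].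
    apply: C0_semigroup_U0 => // t t0.
    by rewrite (le_lt_trans (weight_growth_linear_speed alpha_gt0 r_cont r_gt0 r_int0 r_inty rC t0))// ltry.
  by rewrite L1_opnorm_U0E//; exact: weight_growth_linear_speed.
Qed.
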